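(* Let $n\ge 1$ and $d$ be natural numbers and set $m=\mathfrak{m}^*(i\mapsto\mathfrak{p}_n^i(d),\,n)$, where $\mathfrak{p}_n^i$ is the $i$-fold iterate of $\mathfrak{p}_n$. For every field $K$, every set $\Lambda\subseteq K[X_1,\ldots,X_n]$ of polynomials of total degree at most $d$, and every $f\in K[X_1,\ldots,X_n]$ such that $f^k\in(\Lambda)$ for some $k$, one can write $f=\sum_i c_ir_i$ (a finite sum) with $c_i,r_i\in K[X_1,\ldots,X_n]$ such that $r_i^{2^m}\in(\Lambda)$ for each $i$.
   Context: $(\Lambda)$ denotes the ideal generated by $\Lambda$. Definition of $\mathfrak{m}^*$. Let $\mathbf{E}:\mathbb{N}\to\mathbb{N}$ and let $\tau$ be a finite multiset of natural numbers. If $\tau$ contains $k>0$, then $\tau_{\langle k,i,\mathbf{E}\rangle}$ is obtained from $\tau$ by removing one copy of $k$ and adding $k\cdot(\mathbf{E}(i)-1)$ new copies of $k-1$. If $\tau$ contains $0$, then $\tau_{\langle 0,i,\mathbf{E}\rangle}$ is the result of removing one copy of $0$. Define recursively (well-founded in the multiset ordering) $\mathfrak{m}_{\emptyset,\mathbf{E}}(i)=0$ and, for $\tau\ne\emptyset$, $\mathfrak{m}_{\tau,\mathbf{E}}(i)=1+\mathfrak{m}_{\tau_{\langle\min\tau,i,\mathbf{E}\rangle},\mathbf{E}}(i+1)$. For $\mathbf{D}:\mathbb{N}\to\mathbb{N}$, $\mathfrak{m}^*(\mathbf{D},n)=\mathfrak{m}_{\{n\},\mathbf{D}+1}(0)+1$,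 where $\mathbf{D}+1$ is the function $i\mapsto\mathbf{D}(i)+1$. Definition of $\mathfrak{p}_n$: - $\mathfrak{d}_n(b)=(2b)^{2^n}$; - $\mathfrak{e}(n,b)=2^{(b+\mathfrak{d}_{n-1}(b))^{n-1}+1}\,b+b+\mathfrak{d}_{n-1}(b)$; - $\zeta_0(n,d)=\binom{n+\mathfrak{d}_n(d)}{n}$; - $\zeta_1(n,d,b)=\left(\binom{b+n}{n}+2\right)\zeta_0(n,d)$; - $\zeta_2(n,d,b)=(\zeta_1(n,d,b)+1)^{2^{\zeta_1(n,d,b)}-1}$; - $\mathfrak{p}_1(d)=d$, and for $n\ge 2$, with $\upsilon(n,d)=\zeta_1(n-1,\mathfrak{p}_{n-1}(d),d)\,\zeta_2(n-1,\mathfrak{p}_{n-1}(d),d)$, $\mathfrak{p}_n(d)=\max\left\{2\binom{\upsilon(n,d)+n}{n}\upsilon(n,d),\ \mathfrak{e}(n-1,d)\right\}$. *)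

(* Defs.v *)
From HB Require Import structures.
From mathcomp Require Import all_boot all_order all_algebra.
From mathcomp Require Import finmap multiset mpoly.

Set Implicit Arguments.
Unset Strict Implicit.
Unset Printing Implicit Defensive.

Import GRing.Theory.

Local Open Scope nat_scope.
Local Open Scope mset_scope.

Definition in_ideal (R : comNzRingType) (L : R -> Prop) (f : R) : Prop :=
  exists (s : nat) (c g : 'I_s -> R),
    (forall i, L (g i)) /\ f = (\sum_(i < s) c i * g i)%R.

Definition mset_lt (sigma tau : {mset nat}) : Prop :=
  exists (k : nat) (rho theta : {mset nat}),
    [/\ tau = k +` rho, sigma = theta `+` rho
      & forall j, j \in theta -> j < k].

Lemma mset_rect_D1 (P : {mset nat} -> Prop) :
  P mset0 -> (forall k tau, P tau -> P (k +` tau)) -> forall tau, P tau.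
Proof.
move=> P0 PS tau; rewrite -[tau]seq_mset_id.
elim: (tau : seq nat) => [|k s IHs].
  suff -> : seq_mset [::] = mset0 :> {mset nat} by [].
  by apply/msetP => a; rewrite mset_seqE mset0E.
suff -> : seq_mset (k :: s) = k +` seq_mset s by apply: PS.
by apply/msetP => a; rewrite mset1DE !mset_seqE /= eq_sym.
Qed.

Lemma mset_lt_wf : well_founded mset_lt.
Proof.
have Acc0 : Acc mset_lt mset0.
  constructor => sigma [k [rho [theta [/(congr1 (fun A : {mset nat} => A k))]]]].
  by rewrite mset1DE mset0E eqxx.
have AccD k : forall tau, Acc mset_lt tau -> Acc mset_lt (k +` tau).
  elim/ltn_ind: k => k IHk tau; elim=> {}tau tauP IHtau.
  constructor => sigma [l [rho [theta [def_tau -> theta_lt]]]].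
  have [eq_kl | neq_kl] := eqVneq k l.
    subst l; have <- : tau = rho by rewrite -(msetD1K k tau) def_tau msetD1K.
    have acc_tau : Acc mset_lt tau by constructor.
    elim/mset_rect_D1: theta theta_lt => [|j theta IHtheta] lt_theta.
      by rewrite mset0D.
    rewrite -msetDA; apply: IHk; first by rewrite lt_theta ?mset1D1.
    by apply: IHtheta => i i_theta; rewrite lt_theta ?mset1Dr.
  have k_rho : k \in rho.
    by have := mset1D1 k tau; rewrite def_tau in_mset1D (negPf neq_kl).
  have -> : theta `+` rho = k +` (theta `+` (rho `\ k)).
    by rewrite -{1}(msetB1K k_rho) msetDCA.
  apply: IHtau; exists l, (rho `\ k), theta; split=> //.
  by rewrite -(msetD1K k tau) def_tau -{1}(msetB1K k_rho) msetDCA msetD1K.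
by elim/mset_rect_D1 => // k tau /AccD.
Qed.

(* The minimum of a nonempty multiset; 0 for the empty one. *)
Definition mset_min (tau : {mset nat}) : nat :=
  \big[minn/head 0 tau]_(k <- tau) k.

Lemma mset_min_in (tau : {mset nat}) : tau != mset0 -> mset_min tau \in tau.
Proof.
rewrite /mset_min => tau_neq0.
have: (tau : seq nat) != [::].
  apply: contraNneq tau_neq0 => tau0; apply/eqP/msetP => a.
  by rewrite -count_mem_mset tau0 mset0E.
rewrite -[_ \in tau]/(_ \in (tau : seq nat)).
case: (tau : seq nat) => // a s _; rewrite big_seq.
elim/big_ind: _ => [|x y xs ys|//]; first exact: mem_head.
by rewrite /minn; case: ifP.
Qed.

Lemma mset_min_le (tau : {mset nat}) k : k \in tau -> mset_min tau <= k.
Proof.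
rewrite /mset_min; have -> : (k \in tau) = (k \in (tau : seq nat)) by [].
move: (head _ _) => z; elim: (tau : seq nat) => // a s IHs.
rewrite inE big_cons geq_min => /predU1P[-> | /IHs ->]; first by rewrite leqnn.
by rewrite orbT.
Qed.

(* tau_<k,i,E>, meant for k \in tau and 0 < E i. *)
Definition mset_step (E : nat -> nat) (k i : nat) (tau : {mset nat}) :
    {mset nat} :=
  if k is j.+1 then (tau `\ k) `+` msetn (k * (E i - 1)) j else tau `\ 0.

Lemma mset_step_lt (E : nat -> nat) (i : nat) (tau : {mset nat}) :
  tau != mset0 -> mset_lt (mset_step E (mset_min tau) i tau) tau.
Proof.
move=> /mset_min_in; case: (mset_min tau) => [|j] k_tau /=.
  exists 0, (tau `\ 0), mset0; rewrite msetB1K // mset0D.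
  by split=> // l; rewrite in_mset0.
exists j.+1, (tau `\ j.+1), (msetn (j.+1 * (E i - 1)) j).
rewrite msetB1K // msetDC; split=> // l.
by rewrite in_msetn => /andP[_ /eqP ->].
Qed.

Definition mfun_rel (y x : {mset nat} * nat) : Prop := mset_lt y.1 x.1.

Lemma mfun_rel_wf : well_founded mfun_rel.
Proof.
case=> tau i; elim: (mset_lt_wf tau) i => {}tau _ IHtau i.
by constructor=> -[sigma j] lt_sigma; apply: IHtau lt_sigma _.
Qed.

Definition mfun_body (E : nat -> nat) (x : {mset nat} * nat)
    (rec : forall y, mfun_rel y x -> nat) : nat :=
  match eqVneq x.1 mset0 with
  | EqNotNeq _ => 0
  | NeqNotEq tau_neq0 =>
      1 + rec (mset_step E (mset_min x.1) x.2 x.1, x.2 + 1)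
              (mset_step_lt E x.2 tau_neq0)
  end.

Definition mfun (E : nat -> nat) (tau : {mset nat}) (i : nat) : nat :=
  Fix mfun_rel_wf (fun=> nat) (mfun_body E) (tau, i).

Lemma mfunE (E : nat -> nat) (tau : {mset nat}) (i : nat) :
  mfun E tau i =
    if tau == mset0 then 0
    else 1 + mfun E (mset_step E (mset_min tau) i tau) (i + 1).
Proof.
rewrite {1}/mfun Fix_eq /= => [|x f g eq_fg]; rewrite /mfun_body /=.
  by case: eqVneq.
by case: eqVneq => // h; rewrite eq_fg.
Qed.

Definition mstar (D : nat -> nat) (n : nat) : nat :=
  mfun (fun i => D i + 1) [mset n] 0 + 1.

Definition dbound (n b : nat) : nat := (2 * b) ^ (2 ^ n).

(* Used only for 0 < n. *)
Definition ebound (n b : nat) : nat :=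
  2 ^ ((b + dbound (n - 1) b) ^ (n - 1) + 1) * b + b + dbound (n - 1) b.

Definition zeta0 (n d : nat) : nat := 'C(n + dbound n d, n).

Definition zeta1 (n d b : nat) : nat := ('C(b + n, n) + 2) * zeta0 n d.

Definition zeta2 (n d b : nat) : nat :=
  (zeta1 n d b + 1) ^ (2 ^ zeta1 n d b - 1).

(* Meaningful only for 0 < n; the value at n = 0 is a dummy. In the third case
   the index is n = j.+2, so that n - 1 = j.+1. *)
Fixpoint pbound (n d : nat) : nat :=
  match n with
  | 0 => d
  | 1 => d
  | (j.+1 as n1).+1 =>
      let q := pbound n1 d in
      let upsilon := zeta1 n1 q d * zeta2 n1 q d in
      maxn (2 * 'C(upsilon + n, n) * upsilon) (ebound n1 d)
  end.

(* Main.v *)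
Require Import Defs.
From HB Require Import structures.
From mathcomp Require Import all_boot all_order all_algebra.
From mathcomp Require Import finmap multiset mpoly.
From mathcomp Require Import perm zify.
From Stdlib Require Import Classical.

(** The radical membership exponent is bounded by a function of [n] and [d]
alone: if the generators have degree at most [d] and some power of [f] lies in
the ideal, then [f ^+ N] does, where [N] is [nilp_bound n 1 d].  This number is
at most [(d + 1) ^ ((2n + 4) ^ n)] when [d >= 1] ([nilp_bound_le]), far below
[2 ^ m], so the decomposition of [f] with the single summand [1 * f] has the
required property.

To make an induction on [n] possible, the exponent bound is proved for modules
([nilpotence_bound]): let [A] be the polynomial ring, [W] a submodule of [A ^ r]
generated by vectors with entries of degree at most [d], and [Phi] an
endomorphism of [A ^ r] that maps [W] to itself.  If [Phi] is nilpotent on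
[A ^ r / W], then its nilpotency index is bounded in terms of [n], [r] and [d];
the entries of [Phi] may have any degree.  The theorem is the case where
[r = 1] and [Phi] is multiplication by [f].

Take a minor [delta] of the generators of [W] that is nonzero and of maximal
size.  By Cramer's rule [delta] kills the torsion of [M = A ^ r / W], and modulo
torsion [Phi] is a nilpotent endomorphism of a torsion-free module of rank at
most [r]; therefore [delta * Phi ^ r] vanishes on [M] ([rank_step]).  This is
the result for [n = 0], where [delta] is a unit.  For larger [n], apply the
automorphism X_i |-> X_i + X_0 ^ (e ^ i), for [i > 0], with [e] larger than the
degree of [delta] ([shift_poly]).  It makes [delta] monic in X_0 up to a constant
([shift_poly_lead]), so that [M / delta M] is a quotient of a free module of
finite rank over the polynomial ring in [n - 1] variables, again with relations
of bounded degree.  By induction some [Phi ^ N'] maps [M] into [delta M], so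
[Phi ^ (N' + r)] maps [M] into [delta * Phi ^ r M = 0].

For the comparison with [m], the value of [mfun] is at least the multiplicity of
any number in the multiset, because each step removes only one element.  The
multiset [{n}] has at least [pbound n d] copies of [n - 2] after two steps, hence
[m] exceeds [pbound n d] when [n >= 2] and [d >= 1] ([mstar2_ge]), and
[2 ^ pbound n d] is already at least [nilp_bound n 1 d].  For [n = 1] the same
count gives [d < m], and [nilp_bound 1 1 d = d + 1]; for [d = 0] the bound
is 1. *)

Set Implicit Arguments.
Unset Strict Implicit.
Unset Printing Implicit Defensive.

Import GRing.Theory.
Import Pdiv.Ring Pdiv.RingMonic.

Local Open Scope ring_scope.

(** * Submodules spanned by a set of row vectors *)

(** The same closure as [in_ideal], for vectors instead of ring elements; being
inductive, it lets closure properties be proved by induction on membership. *)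
Inductive lspan (A : comNzRingType) r (L : 'rV[A]_r -> Prop) : 'rV[A]_r -> Prop :=
| lspan0 : lspan L 0
| lspan_cons c g v of L g & lspan L v : lspan L (c *: g + v).

Section Span.
Variables (A : comNzRingType) (r : nat) (L : 'rV[A]_r -> Prop).

Lemma lspan_gen v : L v -> lspan L v.
Proof.
move=> Lv; rewrite -[v]addr0 -{1}[v]scale1r.
exact/lspan_cons/lspan0.
Qed.

Lemma lspanD u v : lspan L u -> lspan L v -> lspan L (u + v).
Proof.
move=> + Sv; elim=> [|c g w Lg _ IH]; rewrite ?add0r // -addrA.
exact: lspan_cons.
Qed.

Lemma lspanZ c v : lspan L v -> lspan L (c *: v).
Proof.
elim=> [|b g w Lg _ IH]; first by rewrite scaler0; apply: lspan0.
by rewrite scalerDr scalerA; apply: lspan_cons.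
Qed.

Lemma lspan_sum I (s : seq I) (P : pred I) (F : I -> 'rV[A]_r) :
  (forall i, P i -> lspan L (F i)) -> lspan L (\sum_(i <- s | P i) F i).
Proof. by move=> SF; elim/big_ind: _ => //; [apply: lspan0 | apply: lspanD]. Qed.

Lemma lspan_mulmx q (G : 'M[A]_(q, r)) (v : 'rV_q) :
  (forall i, lspan L (row i G)) -> lspan L (v *m G).
Proof.
by move=> SG; rewrite mulmx_sum_row; apply: lspan_sum => i _; apply: lspanZ.
Qed.

Lemma lspan_stable (Phi : 'M[A]_r) v :
  (forall w, L w -> lspan L (w *m Phi)) -> lspan L v -> lspan L (v *m Phi).
Proof.
move=> SP; elim=> [|c g w Lg _ IH]; first by rewrite mul0mx; apply: lspan0.
by rewrite mulmxDl -scalemxAl; apply/lspanD/IH/lspanZ/SP.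
Qed.

Lemma lspan_kernel q (P : 'M[A]_(r, q)) v :
  (forall w, L w -> w *m P = 0) -> lspan L v -> v *m P = 0.
Proof.
move=> LP; elim=> [|c g w Lg _ IH]; first by rewrite mul0mx.
by rewrite mulmxDl -scalemxAl LP // IH scaler0 addr0.
Qed.

End Span.

Lemma lspan_map (A B : comNzRingType) (s : {rmorphism A -> B}) r
    (L : 'rV[A]_r -> Prop) (L' : 'rV[B]_r -> Prop) v :
  (forall w, L w -> L' (map_mx s w)) -> lspan L v -> lspan L' (map_mx s v).
Proof.
move=> LL'; elim=> [|c g w Lg _ IH]; first by rewrite map_mx0; apply: lspan0.
by rewrite map_mxD map_mxZ; apply: lspan_cons; first apply: LL'.
Qed.

Lemma lspan_stableX (A : comNzRingType) r (L : 'rV[A]_r -> Prop)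
    (Phi : 'M_r) v k :
  (forall w, L w -> lspan L (w *m Phi)) -> lspan L v -> lspan L (v *m Phi ^+ k).
Proof.
move=> LPhi Lv; elim: k => [|k IH]; first by rewrite expr0 mulmx1.
by rewrite exprSr mulmxA; apply: lspan_stable.
Qed.

Lemma lspan_expW (A : comNzRingType) r (L : 'rV[A]_r -> Prop) (Phi : 'M_r) a b :
    (a <= b)%N -> (forall i, lspan L (row i (Phi ^+ a))) ->
  forall i, lspan L (row i (Phi ^+ b)).
Proof.
move=> le_ab nil i.
have := exprD Phi (b - a) a; rewrite subnK // => ->.
by rewrite row_mul; apply: lspan_mulmx.
Qed.

(** * A maximal minor bounds the nilpotency index modulo torsion *)

(** The minimal polynomial divides both 'X^k and the characteristic polynomial,
so it is a power of 'X of exponent at most [r]. *)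
Lemma nilpotent_mx_field (F : fieldType) r (T : 'M[F]_r) k :
  T ^+ k = 0 -> T ^+ r = 0.
Proof.
case: r T => [|r] T Tk; first by apply/matrixP=> -[].
have: mxminpoly T %| 'X^k.
  by apply: mxminpoly_min; rewrite rmorphXn /= horner_mx_X.
rewrite -[X in X ^+ k]subr0 -(polyC0 F) => /dvdp_exp_XsubCP[j le_j].
rewrite polyC0 subr0 => eqp_j.
have def_T: mxminpoly T = 'X^j.
  by apply/eqP; rewrite -eqp_monic ?mxminpoly_monic ?monicXn.
have le_jr: (j <= r.+1)%N.
  have := dvdp_leq (monic_neq0 (char_poly_monic T)) (mxminpoly_dvd_char T).
  by rewrite def_T size_polyXn size_char_poly.
have := mx_root_minpoly T; rewrite def_T rmorphXn /= horner_mx_X => Tj.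
by have := exprD T j (r.+1 - j); rewrite subnKC // Tj mul0r.
Qed.

Lemma map_mxX (A B : nzRingType) (s : {rmorphism A -> B}) r (S : 'M[A]_r) k :
  map_mx s (S ^+ k) = map_mx s S ^+ k.
Proof.
elim: k => [|k IH]; first exact: map_mx1.
by rewrite !exprS map_mxM IH.
Qed.

Lemma nilpotent_mx (A : idomainType) r (T : 'M[A]_r) k : T ^+ k = 0 -> T ^+ r = 0.
Proof.
move=> Tk; have: map_mx (@tofrac A) T ^+ k = 0 by rewrite -map_mxX Tk map_mx0.
move/nilpotent_mx_field; rewrite -map_mxX => /matrixP TrE.
by apply/matrixP=> i j; have /eqP := TrE i j; rewrite !mxE tofrac_eq0 => /eqP.
Qed.

(** The Schur complement of [D] without division: multiplying the block matrix
on the right by a block lower triangular matrix of determinant [\det D] replaces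
[a] by [\det D * a - b (\adj D) c] and clears [c]. *)
Lemma bordered_minor (A : idomainType) q (a : A) (b : 'rV_q) (c : 'cV_q)
    (D : 'M_q) :
  \det D != 0 -> \det (block_mx a%:M b c D) = 0 ->
  \det D *: a%:M = b *m \adj D *m c.
Proof.
move=> D0 det0.
have := congr1 determinant
  (mulmx_block a%:M b c D (\det D)%:M 0 (- (\adj D *m c)) 1%:M).
rewrite det_mulmx det0 mul0r !mulmx0 !mulmx1 !add0r !mulmxN (mulmxA D) mul_mx_adj.
rewrite [(\det D)%:M *m c]mul_scalar_mx [c *m _]mul_mx_scalar subrr.
rewrite det_ublock det_mx11 => /esym/eqP.
rewrite mulf_eq0 (negPf D0) orbF mxE [X in _ + X]mxE subr_eq0 mulmxA => /eqP e.
by apply/matrixP=> i j; rewrite !ord1 -e mul_scalar_mx !mxE !eqxx !mulr1n mulrC.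
Qed.

(** A minor of maximal size among the nonzero ones with rows in [L].  Its columns
are distinct, so its size is at most [r], and bordering it by one more generator
and one more column gives 0. *)
Lemma max_minor (A : idomainType) r (L : 'rV[A]_r -> Prop) :
  exists q (G : 'M[A]_(q, r)) (f : 'I_q -> 'I_r),
    [/\ (q <= r)%N, forall i, L (row i G), \det (colsub f G) != 0
      & forall w j, L w ->
          \det (block_mx (w 0 j)%:M (colsub f w) (col j G) (colsub f G)) = 0].
Proof.
pose P q := exists (G : 'M[A]_(q, r)) (f : 'I_q -> 'I_r),
  (forall i, L (row i G)) /\ \det (colsub f G) != 0.
have P_le q : P q -> (q <= r)%N.
  case=> G [f [_]] det_neq0; have inj_f : injective f.
    move=> i j eq_f; apply: contraNeq det_neq0 => neq_ij.
    rewrite -det_tr (determinant_alternate neq_ij) // => k.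
    by rewrite !mxE eq_f.
  by have := leq_card f inj_f; rewrite !card_ord.
have P0 : P 0%N.
  exists 0, (fun i : 'I_0 => False_rect _ (notF (ltn_ord i))).
  by split=> [[]//|]; rewrite det_mx00 oner_neq0.
have [q [Pq nPq]] : exists q, P q /\ ~ P q.+1.
  apply: NNPP => noq; suff /P_le : P r.+1 by rewrite ltnn.
  elim: r.+1 => // q IH; apply: NNPP => nP; apply: noq; by exists q.
have le_qr := P_le _ Pq; case: Pq => G [f [LG detG]].
exists q, G, f; split=> // w j Lw.
apply: NNPP => /eqP det_neq0; apply: nPq.
pose g (i : 'I_(1 + q)) := oapp f j (unlift ord0 i).
exists (col_mx w G : 'M_(1 + q, r)), g; split.
  move=> i; have -> : row i (col_mx w G : 'M_(1 + q, r)) =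
      if unlift ord0 i is Some k then row k G else w.
    case: unliftP => [k|] ->; apply/rowP=> k'; rewrite !mxE.
      have -> : lift ord0 k = rshift 1 k by apply/val_inj.
      by rewrite (unsplitK (inr _ _)).
    have -> : ord0 = lshift q (ord0 : 'I_1) by apply/val_inj.
    by rewrite (unsplitK (inl _ _)).
  by case: unliftP.
suff -> : colsub g (col_mx w G : 'M_(1 + q, r)) =
  block_mx (w 0 j)%:M (colsub f w) (col j G) (colsub f G) by [].
rewrite -[LHS]submxK; congr block_mx; apply/matrixP=> i i'; rewrite !mxE.
all: rewrite ?(unsplitK (inl _ _)) ?(unsplitK (inr _ _)) /g ?ord1.
- have -> : lshift q (0 : 'I_1) = ord0 by exact/val_inj.
  by rewrite unlift_none eqxx mulr1n.
- by have -> : rshift 1 i' = lift ord0 i'; [exact/val_inj | rewrite liftK].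
- by have -> : lshift q (0 : 'I_1) = ord0; [exact/val_inj | rewrite unlift_none].
- by have -> : rshift 1 i' = lift ord0 i'; [exact/val_inj | rewrite liftK].
Qed.

(** Torsion-freeness in matrix form.  With [G] the rows and [f] the columns of a
maximal minor [\det D], the matrix [pi] below satisfies [v *m pi = \det D *: v]
modulo the span of [L], and kills that span: its kernel is the torsion of the
quotient module.  Since [pi *m Phi *m pi = \det D *: (Phi *m pi)], the powers of
[Phi *m pi] are, up to powers of [\det D], the matrices [Phi ^+ j *m pi]; thus
[Phi *m pi] is nilpotent, and its index is at most [r]. *)
Lemma rank_step (A : idomainType) r (L : 'rV[A]_r -> Prop) (Phi : 'M[A]_r) k :
    (forall w, L w -> lspan L (w *m Phi)) ->
    (forall i, lspan L (row i (Phi ^+ k))) ->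
  exists q (M : 'M[A]_q),
    [/\ (q <= r)%N,
        forall i, exists2 w, L w & forall j, exists j', M i j = w 0 j',
        \det M != 0
      & forall v, lspan L (\det M *: (v *m Phi ^+ r))].
Proof.
move=> LPhi nilPhi; have [q [G [f [le_qr LG detG bordG]]]] := max_minor L.
set D := colsub f G in detG bordG; exists q, D.
split=> // [i|]; first by exists (row i G) => // j; exists (f j); rewrite !mxE.
pose E : 'M[A]_(r, q) := colsub f 1%:M.
have mulE (v : 'rV_r) : v *m E = colsub f v by rewrite mulmx_colsub mulmx1.
pose pi := (\det D)%:M - E *m \adj D *m G.
have piE (v : 'rV_r) : v *m pi = \det D *: v - colsub f v *m \adj D *m G.
  by rewrite mulmxBr mul_mx_scalar !mulmxA mulE.
have Lpi w : L w -> w *m pi = 0.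
  move=> Lw; apply/eqP; rewrite piE subr_eq0; apply/eqP/rowP=> j.
  have /matrixP/(_ 0 0) := bordered_minor detG (bordG w j Lw).
  rewrite colEsub mulmx_colsub [LHS]mxE [X in _ * X]mxE eqxx mulr1n [RHS]mxE => e.
  by rewrite [LHS]mxE e.
have pi0 v : v *m pi = 0 -> lspan L (\det D *: v).
  move/eqP; rewrite piE subr_eq0 => /eqP ->.
  by apply: lspan_mulmx => i; apply: lspan_gen.
have GPhi : G *m Phi *m pi = 0.
  apply/row_matrixP=> i; rewrite row0 !row_mul.
  exact/(lspan_kernel Lpi)/LPhi/LG.
have piPhi : pi *m (Phi *m pi) = \det D *: (Phi *m pi).
  rewrite {1}/pi mulmxBl -[X in _ - X]mulmxA (mulmxA G) GPhi mulmx0 subr0.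
  by rewrite mul_scalar_mx.
have thetaX j : (Phi *m pi) ^+ j.+1 = \det D ^+ j *: (Phi ^+ j.+1 *m pi).
  elim: j => [|j IH]; first by rewrite !expr1 expr0 scale1r.
  rewrite exprSr IH.
  transitivity ((\det D ^+ j *: (Phi ^+ j.+1 *m pi)) *m (Phi *m pi)) => //.
  rewrite -scalemxAl -mulmxA piPhi -scalemxAr scalerA -exprSr mulmxA.
  by congr (_ *: (_ *m _)); rewrite [RHS]exprSr.
have nil_theta : (Phi *m pi) ^+ k.+1 = 0.
  rewrite thetaX; apply/eqP; rewrite scalemx_eq0; apply/orP; right; apply/eqP.
  apply/row_matrixP=> i; rewrite row0 !row_mul exprSr row_mul.
  exact/(lspan_kernel Lpi)/(lspan_stable LPhi)/nilPhi.
move=> v; apply: pi0; rewrite -mulmxA.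
suff -> : Phi ^+ r *m pi = 0 by rewrite mulmx0.
have [r0 | r_gt0] := posnP r.
  by apply/matrixP=> -[i lti]; exfalso; move: lti; rewrite r0.
move/nilpotent_mx: nil_theta; have := thetaX r.-1; rewrite prednK // => -> /eqP.
by rewrite scalemx_eq0 expf_eq0 (negPf detG) andbF => /eqP.
Qed.

(** * Reduction modulo a monic polynomial *)

Section MonicReduction.
Variables (A : comNzRingType) (delta : {poly A}) (r : nat).
Hypothesis delta_monic : delta \is monic.
Local Notation D := (size delta).-1.

Let size_rmod (p : {poly A}) : (size (rmodp p delta) <= D)%N.
Proof.
by rewrite -ltnS prednK ?size_poly_gt0 ?monic_neq0 // ltn_rmodp monic_neq0.
Qed.

(** Coordinates in the basis 1, 'X, ..., 'X^(D - 1) of each of the [r] summands of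
the free module [({poly A} / delta) ^ r] over [A]. *)
Definition vred (v : 'rV[{poly A}]_r) : 'rV[A]_(r * D) :=
  mxvec (\matrix_(i, j) (rmodp (v 0 i) delta)`_j).

Definition vlift (u : 'rV[A]_(r * D)) : 'rV[{poly A}]_r :=
  \row_i rVpoly (row i (vec_mx u)).

Lemma vredD v w : vred (v + w) = vred v + vred w.
Proof.
rewrite /vred -linearD; congr mxvec; apply/matrixP=> i j.
by rewrite !mxE rmodpD // coefD.
Qed.

Lemma vredZ c v : vred (c%:P *: v) = c *: vred v.
Proof.
rewrite /vred -linearZ; congr mxvec; apply/matrixP=> i j.
by rewrite !mxE mul_polyC rmodpZ // coefZ.
Qed.

Lemma vred_delta v : vred (delta *: v) = 0.
Proof.
rewrite /vred (_ : \matrix_(i, j) _ = 0) ?linear0 //; apply/matrixP=> i j.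
by rewrite !mxE mulrC rmodp_mull // coef0.
Qed.

Lemma vliftK : cancel vlift vred.
Proof.
move=> u; rewrite /vred -[RHS]vec_mxK; congr mxvec; apply/matrixP=> i j.
rewrite !mxE rmodp_small ?coef_rVpoly_ord ?mxE //.
apply: leq_ltn_trans (size_poly _ _) _.
by rewrite ltn_predL lt0n size_poly_eq0 monic_neq0.
Qed.

Lemma vredK v : exists q, v = vlift (vred v) + delta *: q.
Proof.
exists (\row_i rdivp (v 0 i) delta); apply/rowP=> i; rewrite !mxE.
rewrite {1}[v 0 i](rdivp_eq delta_monic) addrC mulrC; congr (_ + _).
rewrite /vred mxvecK -(poly_rV_K (size_rmod _)); congr rVpoly.
by apply/rowP=> j; rewrite !mxE.
Qed.

Lemma vred_inj v w : vred v = vred w -> exists q, v = w + delta *: q.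
Proof.
have [q ->] := vredK v; have [q' ->] := vredK w.
rewrite !vredD !vred_delta !vliftK !addr0 => ->.
by exists (q - q'); rewrite -addrA -scalerDr addrCA subrr addr0.
Qed.

Variables (L : 'rV[{poly A}]_r -> Prop) (Phi : 'M[{poly A}]_r).

(** Generators over [A] of the image of the span of [L]; the powers of 'X below
[D] suffice because they span [{poly A} / delta]. *)
Definition redL (u : 'rV[A]_(r * D)) : Prop :=
  exists w (j : 'I_D), L w /\ u = vred ('X^j *: w).

Definition redPhi : 'M[A]_(r * D) := lin1_mx (fun u => vred (vlift u *m Phi)).

Lemma vlift_linear c u w : vlift (c *: u + w) = c%:P *: vlift u + vlift w.
Proof.
apply/rowP=> i; rewrite !mxE mul_polyC -linearP; congr rVpoly.
by apply/rowP=> j; rewrite !mxE.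
Qed.

Lemma mul_redPhi v : vred v *m redPhi = vred (v *m Phi).
Proof.
pose f u := vred (vlift u *m Phi).
have lin_f : linear f.
  by move=> c u w; rewrite /f vlift_linear mulmxDl -scalemxAl vredD vredZ.
pose fL := GRing.isLinear.Build A _ _ _ f lin_f.
pose g : {linear 'rV[A]_(r * D) -> 'rV[A]_(r * D)} := HB.pack f fL.
rewrite -[LHS]/(vred v *m lin1_mx g) mul_rV_lin1 /= /f.
have [q {2}->] := vredK v.
by rewrite mulmxDl -scalemxAl vredD vred_delta addr0.
Qed.

Lemma mul_redPhiX j v : vred v *m redPhi ^+ j = vred (v *m Phi ^+ j).
Proof.
elim: j v => [|j IH] v; first by rewrite !expr0 !mulmx1.
by rewrite !exprS !mulmxA mul_redPhi IH.
Qed.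

Lemma lspan_redL w : lspan L w -> lspan redL (vred w).
Proof.
elim=> [|c g v Lg _ IH].
  by rewrite -(scaler0 _ delta) vred_delta; apply: lspan0.
rewrite vredD; apply: lspanD IH.
rewrite (rdivp_eq delta_monic c) mulrC scalerDl -scalerA vredD vred_delta add0r.
set p := rmodp c delta.
have -> : p = \sum_(j < D) p`_j *: 'X^j.
  rewrite -poly_def; apply/polyP=> j; rewrite coef_poly.
  by case: ltnP => // le_j; rewrite nth_default // (leq_trans (size_rmod _)).
rewrite scaler_suml.
have vred_sum (F : 'I_D -> 'rV_r) : vred (\sum_j F j) = \sum_j vred (F j).
  apply: big_morph => [u w'|]; first exact: vredD.
  by rewrite -(scaler0 _ delta) vred_delta.
rewrite vred_sum; apply: lspan_sum => j _.
rewrite -mul_polyC -scalerA vredZ; apply/lspanZ/lspan_gen.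
by exists g, j.
Qed.

Lemma redL_lspan u : lspan redL u -> exists2 w, lspan L w & u = vred w.
Proof.
elim=> [|c _ v [w [j [Lw ->]]] _ [w' Lw' ->]].
  by exists 0; [apply: lspan0 | rewrite -(scaler0 _ delta) vred_delta].
exists (c%:P *: ('X^j *: w) + w'); last by rewrite vredD vredZ.
by apply: lspanD Lw'; apply/lspanZ/lspanZ/lspan_gen.
Qed.

Lemma redL_stable : (forall w, L w -> lspan L (w *m Phi)) ->
  forall u, redL u -> lspan redL (u *m redPhi).
Proof.
move=> LPhi _ [w [j [Lw ->]]]; rewrite mul_redPhi -scalemxAl.
exact/lspan_redL/lspanZ/LPhi.
Qed.

Lemma redL_nil k : (forall i, lspan L (row i (Phi ^+ k))) ->
  forall i, lspan redL (row i (redPhi ^+ k)).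
Proof.
move=> nilPhi i; rewrite rowE -[delta_mx _ _]vliftK mul_redPhiX.
exact/lspan_redL/lspan_mulmx.
Qed.

(** Nilpotency over [A] of the induced endomorphism means that a power of [Phi]
maps every vector into the span of [L], up to a multiple of [delta]. *)
Lemma redL_back N : (forall i, lspan redL (row i (redPhi ^+ N))) ->
  forall v, exists w q, lspan L w /\ v *m Phi ^+ N = w + delta *: q.
Proof.
move=> nil v; have [] := redL_lspan (lspan_mulmx (vred v) nil).
rewrite mul_redPhiX => w Lw /vred_inj[q ->].
by exists w, q.
Qed.

End MonicReduction.

(** * Degree bounds *)

Section Degree.
Variables (K : fieldType) (n : nat).
Implicit Types (p q : {mpoly K[n]}) (c d : nat).

Definition deg_le c p := (msize p <= c.+1)%N.

Lemma deg_le_trans c d p : (c <= d)%N -> deg_le c p -> deg_le d p.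
Proof. by move=> le_cd /leq_trans; apply. Qed.

Lemma deg_le0 c : deg_le c 0.
Proof. by rewrite /deg_le msize0. Qed.

Lemma deg_leC c a : deg_le c (a%:MP).
Proof. by rewrite /deg_le msizeC; case: (a != 0). Qed.

Lemma deg_leD c p q : deg_le c p -> deg_le c q -> deg_le c (p + q).
Proof.
move=> hp hq; apply: leq_trans (msizeD_le _ _) _.
by rewrite geq_max; apply/andP.
Qed.

Lemma deg_leN c p : deg_le c p -> deg_le c (- p).
Proof. by rewrite /deg_le msizeN. Qed.

Lemma deg_leM c d p q : deg_le c p -> deg_le d q -> deg_le (c + d) (p * q).
Proof.
rewrite /deg_le => hp hq.
have [->|p0] := eqVneq p 0; first by rewrite mul0r msize0.
have [->|q0] := eqVneq q 0; first by rewrite mulr0 msize0.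
rewrite msizeM //; move: (msize p) (msize q) hp hq => a b; lia.
Qed.

Lemma deg_le_sum c I (s : seq I) (P : pred I) (F : I -> {mpoly K[n]}) :
  (forall i, P i -> deg_le c (F i)) -> deg_le c (\sum_(i <- s | P i) F i).
Proof.
move=> FP; elim/big_ind: _ => // [|p q]; first exact: deg_le0.
exact: deg_leD.
Qed.

Lemma deg_le_det c (q : nat) (M : 'M[{mpoly K[n]}]_q) :
  (forall i j, deg_le c (M i j)) -> deg_le (q * c) (\det M).
Proof.
move=> hM; apply: deg_le_sum => s _.
rewrite mulr_sign.
suff h : deg_le (q * c) (\prod_(i < q) M i (s i)).
  by case: odd_perm => //; apply: deg_leN.
have -> : (q * c = \sum_(i < q) c)%N by rewrite sum_nat_const card_ord.
elim/big_ind2: _ => // [|p1 d1 p2 d2]; first by rewrite -mpolyC1; apply: deg_leC.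
exact: deg_leM.
Qed.

(** The variable of the outer polynomial ring counts separately from the others:
division by a monic polynomial lowers the degree in it at the cost of raising the
other one. *)
Definition bideg_le b c (P : {poly {mpoly K[n]}}) :=
  (size P <= b.+1)%N /\ forall j, deg_le c P`_j.

Implicit Types P Q : {poly {mpoly K[n]}}.

Lemma bideg_le_trans b b' c c' P : (b <= b')%N -> (c <= c')%N ->
  bideg_le b c P -> bideg_le b' c' P.
Proof.
move=> hb hc [sP dP]; split=> [|j]; first by lia.
exact: deg_le_trans (dP j).
Qed.

Lemma bideg_leC b c a : deg_le c a -> bideg_le b c a%:P.
Proof.
move=> ha; split=> [|j]; first by rewrite size_polyC; case: (a != 0).
by rewrite coefC; case: ifP => // _; apply: deg_le0.
Qed.

Lemma bideg_leD b c P Q :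
  bideg_le b c P -> bideg_le b c Q -> bideg_le b c (P + Q).
Proof.
move=> [sP dP] [sQ dQ]; split=> [|j]; last by rewrite coefD; apply: deg_leD.
by apply: leq_trans (size_polyD _ _) _; rewrite geq_max sP sQ.
Qed.

Lemma bideg_leM b b' c c' P Q : bideg_le b c P -> bideg_le b' c' Q ->
  bideg_le (b + b') (c + c') (P * Q).
Proof.
move=> [sP dP] [sQ dQ]; split=> [|j].
  by apply: leq_trans (size_polyMleq _ _) _; lia.
by rewrite coefM; apply: deg_le_sum => i _; apply: deg_leM.
Qed.

Lemma bideg_leXn b c : bideg_le b c 'X^b.
Proof.
split=> [|j]; first by rewrite size_polyXn.
by rewrite coefXn -mpolyC_nat; apply: deg_leC.
Qed.

Lemma bideg_le_exp b c P m : bideg_le b c P -> bideg_le (m * b) (m * c) (P ^+ m).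
Proof.
move=> hP; elim: m => [|m IH]; first exact/bideg_leC/deg_leC.
by rewrite exprS !mulSn; apply: bideg_leM.
Qed.

(** Each step of the division lowers the size by one and subtracts a product
of [delta], a power of 'X and a coefficient of the current remainder, which
raises the degree of the coefficients by at most [e]. *)
Lemma rmodp_deg delta b c e P :
    delta \is monic -> (forall j, deg_le e delta`_j) ->
    (size P <= b + (size delta).-1)%N -> (forall j, deg_le c P`_j) ->
  forall j, deg_le (c + b * e) (rmodp P delta)`_j.
Proof.
move=> delta_monic ddelta; elim: b c P => [|b IH] c P sP dP j.
  rewrite rmodp_small ?mul0n ?addn0 //.
  by apply: leq_ltn_trans sP _; rewrite ltn_predL lt0n size_poly_eq0 monic_neq0.
set D := (size delta).-1 in sP.
have def_size : size delta = D.+1.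
  by rewrite prednK // lt0n size_poly_eq0 monic_neq0.
pose Q := P - (P`_(b + D))%:P * 'X^b * delta.
have -> : rmodp P delta = rmodp Q delta.
  by rewrite /Q rmodpB // -mulrA mulrA rmodp_mull // subr0.
rewrite mulSn addnA; apply: IH => [|i]; last first.
  rewrite coefB; apply: deg_leD; first by apply: deg_le_trans (dP i); lia.
  apply: deg_leN; rewrite -mulrA coefCM; apply: deg_leM => //.
  by rewrite coefXnM; case: ltnP => // _; apply: deg_le0.
apply/leq_sizeP => i le_i; rewrite coefB -mulrA coefCM coefXnM ltnNge.
rewrite (_ : b <= i)%N /=; last by lia.
move: le_i; rewrite leq_eqVlt => /predU1P[<-|lt_i].
  have := monicP delta_monic; rewrite lead_coefE -/D addKn => ->.
  by rewrite mulr1 subrr.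
rewrite [P`_i]nth_default ?(leq_trans sP) ?addSn //.
by rewrite [delta`_(_)]nth_default ?mulr0 ?subr0 // def_size; lia.
Qed.

End Degree.

(** * Making a polynomial monic by a change of variables *)

(** Uniqueness of the digits in base [e], the first one being the remainder. *)
Lemma digits_inj e n (a b : 'I_n -> nat) :
    (forall i, a i < e)%N -> (forall i, b i < e)%N ->
  (\sum_i a i * e ^ i = \sum_i b i * e ^ i)%N -> a =1 b.
Proof.
elim: n a b => [|n IH] a b ha hb; first by move=> _ [].
have e_gt0 : (0 < e)%N by apply: leq_ltn_trans (ha ord0).
have shift (c : 'I_n.+1 -> nat) : (\sum_i c i * e ^ i =
    (\sum_(i < n) c (lift ord0 i) * e ^ i) * e + c ord0)%N.
  rewrite big_ord_recl expn0 muln1 addnC big_distrl /=; congr (_ + _)%N.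
  by apply: eq_bigr => i _; rewrite -mulnA -expnSr.
rewrite !shift => eq_ab.
have eq0 : a ord0 = b ord0.
  by have := congr1 (modn^~ e) eq_ab; rewrite !modnMDl !modn_small.
have eqS : (fun i => a (lift ord0 i)) =1 (fun i => b (lift ord0 i)).
  apply: IH => // ; apply/eqP; rewrite -(eqn_pmul2r e_gt0).
  by move: eq_ab; rewrite eq0 => /addIn ->.
by move=> i; case: (unliftP ord0 i) => [j|] -> //; apply: eqS.
Qed.

Section Shift.
Variables (K : fieldType) (n e : nat).
Hypothesis e_gt0 : (0 < e)%N.

(** The variable of index 0 becomes the variable 'X of the outer polynomial ring;
the others are renumbered and translated by a power of 'X. *)
Definition shift_var (i : 'I_n.+1) : {poly {mpoly K[n]}} :=
  (oapp (fun j => 'X_j) 0 (unlift ord0 i))%:P + 'X^(e ^ i).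

Definition shift_poly : {mpoly K[n.+1]} -> {poly {mpoly K[n]}} :=
  mmap (polyC \o @mpolyC n K) shift_var.

HB.instance Definition _ := GRing.RMorphism.on shift_poly.

(** Together with 'X |-> 'X_ord0, this undoes the change of variables. *)
Definition unshift_coef : {mpoly K[n]} -> {mpoly K[n.+1]} :=
  mmap (@mpolyC n.+1 K) (fun j => 'X_(lift ord0 j) - 'X_ord0 ^+ (e ^ j.+1)).

HB.instance Definition _ := GRing.RMorphism.on unshift_coef.

Definition unshift_poly : {poly {mpoly K[n]}} -> {mpoly K[n.+1]} :=
  horner_eval ('X_ord0) \o map_poly unshift_coef.

HB.instance Definition _ := GRing.RMorphism.on unshift_poly.

Lemma unshift_polyE P : unshift_poly P = (map_poly unshift_coef P).['X_ord0].
Proof. by []. Qed.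

Lemma shift_polyK : cancel shift_poly unshift_poly.
Proof.
move=> p; rewrite {1}/shift_poly /mmap rmorph_sum [RHS]mpolyE.
apply: eq_bigr => m _.
rewrite rmorphM -mul_mpolyC; congr (_ * _).
  by rewrite /= unshift_polyE map_polyC hornerC /= /unshift_coef mmapC.
rewrite /mmap1 rmorph_prod mpolyXE_id; apply: eq_bigr => i _.
rewrite rmorphXn; congr (_ ^+ _).
rewrite /= unshift_polyE /shift_var rmorphD /= map_polyC map_polyXn.
rewrite hornerD hornerC hornerXn.
case: unliftP => [j|] -> /=; last by rewrite /unshift_coef rmorph0 add0r expr1.
by rewrite /unshift_coef mmapX mmap1U subrK.
Qed.

(** The degree in 'X of the image of a monomial under [shift_poly].  On monomials
with exponents below [e] it is injective, being a number with given digits in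
base [e]. *)
Definition weight (m : 'X_{1..n.+1}) : nat := \sum_i m i * e ^ i.

Lemma shift_var_monic i :
  shift_var i \is monic /\ size (shift_var i) = (e ^ i).+1.
Proof.
rewrite /shift_var; set c := oapp _ _ _.
have lt : (size c%:P < size ('X^(e ^ i) : {poly {mpoly K[n]}}))%N.
  apply: leq_ltn_trans (size_polyC_leq1 _) _.
  by rewrite size_polyXn ltnS expn_gt0 e_gt0.
rewrite monicE lead_coefDr // lead_coefXn eqxx addrC size_polyDl //.
by rewrite size_polyXn.
Qed.

Lemma mmap1_shift m :
  mmap1 shift_var m \is monic /\ size (mmap1 shift_var m) = (weight m).+1.
Proof.
rewrite /mmap1 /weight; elim/big_ind2: _ => [|P a Q b [mP sP] [mQ sQ]|i _].
- by rewrite monic1 size_poly1.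
- by rewrite monicMl // size_monicM ?monic_neq0 // sP sQ addnS.
have [mi si] := shift_var_monic i; split; first exact: monic_exp.
elim: (m i) => [|k IH]; first by rewrite size_poly1.
by rewrite exprS size_monicM ?monic_neq0 ?monic_exp // IH si mulSn addSn addnS.
Qed.

(** The monomials of [p] have images that are monic of distinct degrees, so the
leading coefficient comes from a single monomial and is a constant. *)
Lemma shift_poly_lead p : p != 0 -> (msize p <= e)%N ->
  exists2 c : K, c != 0 & lead_coef (shift_poly p) = c%:MP.
Proof.
move=> p_neq0 le_pe.
have [m0 m0p max_m0] : exists2 m0, m0 \in msupp p &
    forall m, m \in msupp p -> (weight m <= weight m0)%N.
  have: msupp p != [::] by rewrite msupp_eq0.
  elim: (msupp p) => // m s IH _; have [->|/IH[m1 m1s max1]] := eqVneq s [::].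
    by exists m => [|m']; rewrite inE // => /eqP ->.
  have [le_m|lt_m] := leqP (weight m) (weight m1).
    exists m1 => [|m']; rewrite inE ?m1s ?orbT // => /predU1P[-> //|].
    exact: max1.
  exists m => [|m']; rewrite inE ?eqxx // => /predU1P[-> //|/max1 le_m'].
  exact: leq_trans le_m' (ltnW lt_m).
have lt_m0 m : m \in msupp p -> m != m0 -> (weight m < weight m0)%N.
  move=> mp; rewrite ltn_neqAle max_m0 // andbT; apply: contra_neq => eq_w.
  have small m1 : m1 \in msupp p -> forall i, (m1 i < e)%N.
    move=> /msize_mdeg_lt lt_m1 i; apply: leq_trans le_pe.
    by apply: leq_trans lt_m1; rewrite ltnS mdegE (bigD1 i) //= leq_addr.
  apply/mnmP=> i; apply: (digits_inj (small _ mp) (small _ m0p)) => //.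
have coef0 : (shift_poly p)`_(weight m0) = (p@_m0)%:MP.
  rewrite /shift_poly /mmap coef_sum (bigD1_seq m0) //= ?msupp_uniq //.
  rewrite big_seq_cond big1 => [|m /andP[mp nm]].
    rewrite addr0 coefCM; have [mm sm] := mmap1_shift m0.
    by have := monicP mm; rewrite lead_coefE sm => ->; rewrite mulr1.
  by rewrite coefCM [X in _ * X]nth_default ?mulr0 // (mmap1_shift m).2 lt_m0.
have sz : size (shift_poly p) = (weight m0).+1.
  apply/eqP; rewrite eqn_leq; apply/andP; split.
    apply: leq_trans (size_sum _ _ _) _; apply/bigmax_leqP_seq => m mp _.
    apply: leq_trans (size_polyMleq _ _) _; rewrite (mmap1_shift m).2.
    have := size_polyC_leq1 (mpolyC n p@_m); have := max_m0 m mp => /=.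
    by move: (size _) (weight m) => a b; lia.
  rewrite ltnNge; apply: contraTN m0p => /leq_sizeP/(_ _ (leqnn _)).
  by rewrite coef0 => /eqP; rewrite mpolyC_eq0 mcoeff_eq0.
exists p@_m0; first by rewrite -mcoeff_msupp.
by rewrite lead_coefE sz.
Qed.

Lemma shift_var_bideg i : bideg_le (e ^ n) 1 (shift_var i).
Proof.
apply: bideg_leD; last first.
  apply: bideg_le_trans (bideg_leXn K n (e ^ i) 1) => //.
  by rewrite leq_pexp2l // -ltnS.
apply: bideg_leC; case: unliftP => [j|] _ /=; last exact: deg_le0.
by rewrite /deg_le msizeX mdeg1.
Qed.

Lemma shift_poly_bideg d p : deg_le d p -> bideg_le (d * e ^ n) d (shift_poly p).
Proof.
move=> dp; rewrite /shift_poly /mmap big_seq.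
elim/big_ind: _ => [||m mp]; first exact/bideg_leC/deg_le0.
  by move=> P Q; apply: bideg_leD.
have le_md : (mdeg m <= d)%N.
  by rewrite -ltnS; apply: leq_trans (msize_mdeg_lt mp) dp.
rewrite -[(d * _)%N]add0n -[X in bideg_le _ X]add0n; apply: bideg_leM.
  exact/bideg_leC/deg_leC.
apply: (@bideg_le_trans _ _ (mdeg m * e ^ n) _ (mdeg m)) => //.
  by rewrite leq_mul2r le_md orbT.
rewrite /mmap1 mdegE.
suff : bideg_le (\sum_i (m i * e ^ n)) (\sum_i (m i * 1))
    (\prod_i shift_var i ^+ m i).
  by rewrite -!big_distrl /= muln1.
elim/big_ind3: _ => [|b c P b' c' Q|i _]; first exact/bideg_leC/deg_leC.
  exact: bideg_leM.
exact/bideg_le_exp/shift_var_bideg.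
Qed.
End Shift.

(** * The uniform nilpotency bound *)

(** In the step, [r * d] bounds the degree of the minor [delta], the change of
variables with base [(r * d).+1] multiplies degrees in 'X by at most [b], and
division by [delta] of vectors of degree at most [d * b] in 'X adds at most
[d * b * (r * d)] to the degree of the coefficients. *)
Fixpoint nilp_bound (n r d : nat) : nat :=
  if n is n'.+1 then
    let b := ((r * d).+1 ^ n')%N in
    (nilp_bound n' (r * (r * d * b)) (d + d * b * (r * d)) + r)%N
  else r.

Lemma leq_nilp_bound n r r' d d' : (r <= r')%N -> (d <= d')%N ->
  (nilp_bound n r d <= nilp_bound n r' d')%N.
Proof.
elim: n r r' d d' => [|n IH] r r' d d' hr hd //=.
have hb : ((r * d).+1 ^ n <= (r' * d').+1 ^ n)%N.
  by case: n {IH} => // n; rewrite leq_exp2r // ltnS leq_mul.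
by apply: leq_add => //; apply: IH; rewrite ?leq_add ?leq_mul.
Qed.

(** Induction on the number of variables.  Some power [N'] of [Phi] is zero on the
module modulo [delta] by the case of one variable less, and the remaining factor
[Phi ^+ r] is zero on multiples of [delta] by [rank_step]. *)
Lemma nilpotence_bound (K : fieldType) n r d (L : 'rV[{mpoly K[n]}]_r -> Prop)
    (Phi : 'M[{mpoly K[n]}]_r) k :
    (forall w, L w -> forall j, deg_le d (w 0 j)) ->
    (forall w, L w -> lspan L (w *m Phi)) ->
    (forall i, lspan L (row i (Phi ^+ k))) ->
  forall i, lspan L (row i (Phi ^+ nilp_bound n r d)).
Proof.
elim: n r d L Phi k => [|n IH] r d L Phi k Ld LPhi nilPhi i.
  have [q [M [_ _ detM spanM]]] := rank_step LPhi nilPhi.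
  (* Over the ring of polynomials in no variables, [\det M] is a unit. *)
  have det_const : \det M = ((\det M)@_0)%:MP.
    apply/mpolyP=> m; rewrite mcoeffC (_ : m = 0%MM) ?eqxx ?mulr1 //.
    by apply/mnmP=> -[].
  have c0 : (\det M)@_0 != 0 by rewrite -(mpolyC_eq0 0) -det_const.
  have := lspanZ (((\det M)@_0)^-1)%:MP (spanM (delta_mx 0 i)).
  by rewrite scalerA {2}det_const -mpolyCM mulVf // mpolyC1 scale1r -rowE.
have [q [M [le_qr LM detM spanM]]] := rank_step LPhi nilPhi.
have Md i' j : deg_le d (M i' j).
  by have [w Lw wE] := LM i'; have [j' ->] := wE j; apply: Ld.
have dd : deg_le (r * d) (\det M).
  by apply: deg_le_trans (deg_le_det Md); rewrite leq_mul2r le_qr orbT.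
pose e := (r * d).+1; have e_gt0 : (0 < e)%N by [].
pose s : {rmorphism {mpoly K[n.+1]} -> {poly {mpoly K[n]}}} := shift_poly e.
pose t : {rmorphism {poly {mpoly K[n]}} -> {mpoly K[n.+1]}} := unshift_poly e.
have sK : cancel s t by apply: shift_polyK.
have smK a b : cancel (@map_mx _ _ s a b) (map_mx t).
  by move=> B; apply/matrixP=> i1 j1; rewrite !mxE sK.
have [c c_neq0 lead_s] := shift_poly_lead e_gt0 detM dd.
(* Dividing by the constant leading coefficient keeps the same principal ideal. *)
pose delta : {poly {mpoly K[n]}} := ((c^-1)%:MP)%:P * s (\det M).
have delta_monic : delta \is monic.
  by rewrite monicE lead_coefM lead_coefC /= lead_s -mpolyCM mulVf ?mpolyC1.
have [size_delta deg_delta] : bideg_le (r * d * e ^ n) (r * d) delta.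
  rewrite -[(_ * e ^ n)%N]add0n -[(r * d)%N in X in bideg_le _ X]add0n.
  by apply: bideg_leM (shift_poly_bideg e_gt0 dd); apply/bideg_leC/deg_leC.
pose Ls (v : 'rV_r) := exists2 w, L w & v = map_mx s w.
pose Phis := map_mx s Phi.
have Ls_stable w : Ls w -> lspan Ls (w *m Phis).
  case=> w0 Lw0 ->; rewrite -map_mxM; apply: lspan_map (LPhi _ Lw0).
  by move=> w1 Lw1; exists w1.
have Ls_nil j : lspan Ls (row j (Phis ^+ k)).
  rewrite -map_mxX -map_row; apply: lspan_map (nilPhi j).
  by move=> w1 Lw1; exists w1.
set b := (e ^ n)%N in size_delta.
pose d' := (d + d * b * (r * d))%N.
have redLd u : redL (delta := delta) Ls u -> forall j, deg_le d' (u 0 j).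
  case=> _ [j [[w Lw ->] ->]] l; case/mxvec_indexP: l => i1 j1.
  rewrite mxvecE !mxE.
  have := shift_poly_bideg e_gt0 (Ld _ Lw i1); rewrite -/b => -[size_w deg_w].
  apply: (rmodp_deg delta_monic deg_delta); last first.
    by move=> l; rewrite coefXnM; case: ltnP => // _; apply: deg_le0.
  apply: leq_trans (size_polyMleq _ _) _; rewrite size_polyXn /=.
  rewrite [leqRHS]addnC -ltnS -addSn -addnS.
  exact: leq_add (ltn_ord j) size_w.
have red_stable := redL_stable delta_monic Ls_stable.
have red_nil := redL_nil delta_monic Ls_nil.
have {red_nil} := IH _ _ _ _ _ redLd red_stable red_nil.
set N' := nilp_bound n (r * (r * d * b)) d'.
have le_N' : (nilp_bound n (r * (size delta).-1) d' <= N')%N.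
  by apply: leq_nilp_bound => //; rewrite leq_mul2l; apply/orP; right; lia.
move/(lspan_expW le_N')/(redL_back delta_monic) => back.
rewrite /= -/e -/b -/d' -/N' exprD row_mul.
have [w [p [Lw]]] := back (map_mx s (delta_mx 0 i)).
rewrite -map_mxX -map_mxM -rowE => /(congr1 (map_mx t)).
rewrite smK map_mxD map_mxZ rmorphM sK => ->.
rewrite mulmxDl; apply: lspanD.
  apply: lspan_stableX => //; apply: lspan_map Lw.
  by move=> _ [w0 Lw0 ->]; rewrite smK.
by rewrite -scalemxAl -scalerA; apply/lspanZ/spanM.
Qed.

Lemma in_ideal_lspan (A : comNzRingType) (L : A -> Prop) f :
  in_ideal L f -> lspan (fun v : 'rV_1 => L (v 0 0)) (f%:M).
Proof.
case=> s [c [g [Lg ->]]].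
have -> : (\sum_i c i * g i)%:M = \sum_i (c i * g i)%:M :> 'rV[A]_1.
  by rewrite -[RHS](raddf_sum (@scalar_mx A 1)).
apply: lspan_sum => i _.
by rewrite /= -scale_scalar_mx; apply/lspanZ/lspan_gen; rewrite mxE eqxx mulr1n.
Qed.

Lemma lspan_in_ideal (A : comNzRingType) (L : A -> Prop) (v : 'rV_1) :
  lspan (fun v : 'rV_1 => L (v 0 0)) v -> in_ideal L (v 0 0).
Proof.
elim=> [|c g w Lg _ [s [b [h [Lh wE]]]]].
  by exists 0%N, (fun=> 0), (fun=> 0); split=> [[]//|]; rewrite big_ord0 mxE.
exists s.+1, (fun i => oapp b c (unlift ord0 i)),
  (fun i => oapp h (g 0 0) (unlift ord0 i)).
split=> [i|]; first by case: unliftP => /=.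
rewrite !mxE wE big_ord_recl unlift_none /=; congr (_ + _).
by apply: eq_bigr => i _; rewrite liftK.
Qed.

(** The case of the module [{mpoly K[n]} / (L)] and the multiplication by [f]. *)
Lemma noether_exponent (K : fieldType) n d (L : {mpoly K[n]} -> Prop) f k N :
    (forall g, L g -> msize g <= d.+1)%N -> in_ideal L (f ^+ k) ->
  (nilp_bound n 1 d <= N)%N -> in_ideal L (f ^+ N).
Proof.
move=> Ld fk leN; pose Lv (v : 'rV_1) := L (v 0 0).
have expE j : (f%:M : 'M_1) ^+ j = (f ^+ j)%:M.
  by elim: j => [|j IH] //; rewrite !exprS IH -[LHS]/(_ *m _) -scalar_mxM.
have rowE (a : {mpoly K[n]}) (i : 'I_1) : row i (a%:M : 'M_1) = a%:M.
  by apply/rowP=> j; rewrite !mxE !ord1.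
have LvPhi v : Lv v -> lspan Lv (v *m f%:M).
  by move=> Lv0; rewrite mul_mx_scalar; apply/lspanZ/lspan_gen.
have nil (i : 'I_1) : lspan Lv (row i (f%:M ^+ k)).
  by rewrite expE rowE; apply: in_ideal_lspan.
have Lvd v : Lv v -> forall j, deg_le d (v 0 j).
  by move=> /Ld + j; rewrite ord1.
have := lspan_expW leN (nilpotence_bound Lvd LvPhi nil) 0.
by rewrite expE rowE => /lspan_in_ideal; rewrite mxE eqxx mulr1n.
Qed.

(** * Comparison with the bound of the theorem *)

Section Numerics.
Local Open Scope nat_scope.
Local Open Scope mset_scope.

(** Every step of the recursion costs 1 and removes only one element, so it takes
at least [tau a] steps to remove the copies of [a]. *)
Lemma mfun_ge_mult E (tau : {mset nat}) i a : tau a <= mfun E tau i.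
Proof.
elim: (mset_lt_wf tau) i => {}tau _ IH i; rewrite mfunE.
have [-> | tau0] := eqVneq tau mset0; first by rewrite mset0E.
apply: leq_trans (leq_add (leqnn 1) (IH _ (mset_step_lt E i tau0) _)).
have le1 b : tau a <= 1 + (tau `\ b) a.
  by rewrite msetB1E -leq_subLR leq_sub2l ?leq_b1.
case: (mset_min tau) => [|j] //=.
by rewrite msetE2 addnA; apply: leq_trans (le1 _) (leq_addr _ _).
Qed.

Lemma mset_min_msetn m j : 0 < m -> mset_min (msetn m j) = j.
Proof.
move=> m0; have /mset_min_in : msetn m j != mset0.
  by apply/eqP => /msetP/(_ j); rewrite msetnE eqxx mset0E; lia.
by rewrite in_msetn => /andP[_ /eqP].
Qed.

Lemma mset1_step E k i :
  mset_step E k.+1 i [mset k.+1] = msetn (k.+1 * (E i - 1)) k.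
Proof.
apply/msetP=> a; rewrite /= msetE2 msetB1E msetnE.
by rewrite msetnE; case: (a == k.+1).
Qed.

Lemma mset_min1 k : mset_min [mset k] = k.
Proof. exact: mset_min_msetn. Qed.

Lemma mset1_neq0 k : [mset k] != mset0 :> {mset nat}.
Proof. by apply/eqP => /msetP/(_ k); rewrite msetnE eqxx mset0E. Qed.

Lemma mstar1_ge D : D 0 < mstar D 1.
Proof.
rewrite /mstar mfunE (negPf (mset1_neq0 1)) mset_min1 mset1_step.
have := mfun_ge_mult (fun i => D i + 1) (msetn (1 * (D 0 + 1 - 1)) 0) (0 + 1) 0.
by rewrite msetnxx mul1n addnK; move: (mfun _ _ _) => x; lia.
Qed.

Lemma mstar2_ge D n : 0 < D 0 -> D 1 < mstar D n.+2.
Proof.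
move=> D0; rewrite /mstar mfunE (negPf (mset1_neq0 _)) mset_min1 mset1_step mfunE.
set m := n.+2 * _; have m_gt0 : 0 < m by rewrite /m addnK muln_gt0.
rewrite mset_min_msetn // ifN; last first.
  by apply/eqP => /msetP/(_ n.+1); rewrite msetnE eqxx mset0E; lia.
have := mfun_ge_mult (fun i => D i + 1)
  (mset_step (fun i => D i + 1) n.+1 (0 + 1) (msetn m n.+1)) (0 + 1 + 1) n.
rewrite msetE2 msetnxx addnK => le_mfun.
rewrite addn1 ltnS; do 2 apply: leq_trans (leq_addl 1 _).
apply: leq_trans le_mfun; apply: leq_trans (leq_addl _ _).
by rewrite leq_pmull.
Qed.

(** One step of the recursion replaces [t] by [t ^ (c - 1)] and adds less than
[t]; the exponent [c] instead of [c - 1] absorbs this summand. *)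
Lemma nilp_bound_le c n r d t : 2 * n + 4 <= c -> 1 < t -> r < t -> d < t ->
  nilp_bound n r d <= t ^ (c ^ n).
Proof.
elim: n r d t => [|n IH] r d t hc ht hr hd; first by rewrite expn0 expn1 /=; lia.
rewrite /=; set b := _ ^ n.
have hb : b <= t ^ (2 * n).
  rewrite expnM /b; case: (n) => // k; rewrite leq_exp2r // -mulnn.
  apply: leq_ltn_trans (leq_mul (leqnn r) (ltnW hd)) _.
  by rewrite ltn_pmul2r; lia.
set r' := r * _; set d' := d + _.
have t2n : 0 < t ^ (2 * n) by rewrite expn_gt0; lia.
have rd : r * d <= t * t by apply: leq_mul; apply: ltnW.
set X := t ^ (2 * n) in hb t2n.
have tX : t * t * (t * t * t * X) <= t ^ (c - 1).
  have -> : t * t * (t * t * t * X) = t ^ (2 * n + 5).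
    by rewrite expnD -/X !expnS expn0; lia.
  by rewrite leq_pexp2l //; lia.
have r'X : r' <= t * t * t * X.
  rewrite (_ : t * t * t * X = t * (t * t * X)); last by lia.
  by rewrite /r'; apply: leq_mul; [exact: ltnW | exact: leq_mul].
have d'X : d' <= t + t * t * t * X.
  rewrite (_ : t * t * t * X = t * X * (t * t)); last by lia.
  apply: leq_add; first exact: ltnW.
  by apply: leq_mul => //; apply: leq_mul => //; apply: ltnW.
have Yt : t + t * t * t * X < t * t * (t * t * t * X).
  have : t <= t * t * t * X by rewrite -!mulnA leq_pmulr // !muln_gt0 t2n; lia.
  move: (t * t * t * X) => Y; nia.
have hr' : r' < t ^ (c - 1) by lia.
have hd' : d' < t ^ (c - 1) by lia.
have {}IH := IH r' d' (t ^ (c - 1)) _ _ hr' hd'.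
have le1 : nilp_bound n r' d' <= t ^ ((c - 1) * c ^ n).
  rewrite expnM; apply: IH; first by lia.
  by apply: leq_trans (leq_pexp2l _ _ : t ^ 1 <= _); lia.
have : t ^ ((c - 1) * c ^ n) + t <= t ^ (c ^ n.+1).
  have cn : 0 < c ^ n by rewrite expn_gt0; lia.
  apply: leq_trans (_ : t ^ ((c - 1) * c ^ n).+1 <= _); last first.
    by rewrite leq_pexp2l ?expnS //; [lia | nia].
  rewrite expnS; apply: (@leq_trans (2 * t ^ ((c - 1) * c ^ n))); last first.
    by rewrite leq_mul2r ht orbT.
  rewrite mul2n -addnn leq_add2l; apply: (leq_trans (_ : t <= t ^ 1)) => //.
  by rewrite leq_pexp2l //; nia.
by lia.
Qed.

Lemma leq_bin_add n d : 0 < d -> d + n.+1 <= 'C(d + n.+1, n.+1).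
Proof.
move=> d0; elim: n => [|n IH]; first by rewrite bin1.
by rewrite [in X in _ <= X]addnS binS addnS -addn1 addnC leq_add // bin_gt0; lia.
Qed.

Lemma zeta1_gt n q d : 0 < d -> n + d + 2 < zeta1 n.+1 q d.
Proof.
move=> d0; have := leq_bin_add n d0.
have : 0 < zeta0 n.+1 q by rewrite bin_gt0 leq_addr.
by rewrite /zeta1; nia.
Qed.

(** The factor [zeta2 n.+1 _ d] of [pbound n.+2 d] is enough: its base exceeds [d]
and the square root of [2 * n.+2 + 4], and its exponent exceeds [2 * n.+2]. *)
Lemma pbound_ge n d : 0 < d -> d * (2 * n.+2 + 4) ^ n.+2 <= pbound n.+2 d.
Proof.
move=> d0; set p := pbound n.+2 d.
set q := pbound n.+1 d; set z1 := zeta1 n.+1 q d; set z2 := zeta2 n.+1 q d.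
have z1_gt : n + d + 2 < z1 by apply: zeta1_gt.
have : z2 <= p.
  rewrite -[p]/(maxn (2 * 'C(z1 * z2 + n.+2, n.+2) * (z1 * z2)) (ebound n.+1 d)).
  rewrite leq_max; apply/orP; left; rewrite mulnA leq_pmull //.
  by rewrite muln_gt0 (leq_trans _ z1_gt) // andbT muln_gt0 bin_gt0 leq_addl.
apply: leq_trans; rewrite /z2 /zeta2 -/z1; move: z1 z1_gt => z z_gt.
apply: (@leq_trans ((z + 1) ^ (1 + 2 * n.+2))).
  rewrite expnD expn1 expnM; apply: leq_mul; first by lia.
  by rewrite leq_exp2r // -mulnn; nia.
rewrite leq_pexp2l ?addn1 //.
have : 2 ^ (n + 4) <= 2 ^ z by rewrite leq_pexp2l //; lia.
by have := ltn_expl n (isT : 1 < 2); rewrite expnD; lia.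
Qed.

Lemma nilp_bound_deg0 n r : nilp_bound n r 0 <= r.
Proof.
elim: n r => // n IH r; rewrite /= !(muln0, mul0n, addn0).
by have := IH 0; lia.
Qed.

Lemma nilp_bound_mstar n d : 0 < n ->
  nilp_bound n 1 d <= 2 ^ mstar (fun i => iter i (pbound n) d) n.
Proof.
case: n => // n _; set D := fun _ => _; set m := mstar D _.
have [-> | d0] := posnP d.
  by apply: leq_trans (nilp_bound_deg0 _ _) _; rewrite expn_gt0.
case: n => [|n] in D m *.
  have : d < m by exact: (mstar1_ge D).
  rewrite /= expn0 !mul1n muln1; have := ltn_expl m (isT : 1 < 2); lia.
have lt_m : pbound n.+2 d < m by exact: (@mstar2_ge D n d0).
have le_m := leq_trans (pbound_ge n d0) (ltnW lt_m).
have := @nilp_bound_le (2 * n.+2 + 4) n.+2 1 d d.+1 (leqnn _) d0 d0 (ltnSn d).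
have : 0 < (2 * n.+2 + 4) ^ n.+2 by rewrite expn_gt0 addn_gt0 orbT.
move: (_ ^ n.+2) le_m => c le_m c_gt0 le_nilp; apply: leq_trans le_nilp _.
apply: (@leq_trans ((2 ^ d) ^ c)); first by rewrite leq_exp2r // ltn_expl.
by rewrite -expnM leq_pexp2l.
Qed.

End Numerics.

Theorem theorem4p10 (n d : nat) (hn : (1 <= n)%N) :
  let m := mstar (fun i => iter i (pbound n) d) n in
  forall (K : fieldType) (L : {mpoly K[n]} -> Prop),
    (forall g : {mpoly K[n]}, L g -> (msize g <= d.+1)%N) ->
    forall f : {mpoly K[n]},
      (exists k : nat, in_ideal L (f ^+ k)) ->
      exists (s : nat) (c r : 'I_s -> {mpoly K[n]}),
        f = \sum_(i < s) c i * r i /\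
        forall i : 'I_s, in_ideal L (r i ^+ (2 ^ m)%N).
Proof.
move=> m K L Ld f [k fk]; exists 1%N, (fun=> 1), (fun=> f).
split=> [|_]; first by rewrite big_ord1 mul1r.
exact: noether_exponent Ld fk (nilp_bound_mstar d hn).
Qed.
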